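(* Let $\mathcal C=\mathcal C(a_i,b_i)$ and $\mathcal C'=\mathcal C(a_i',b_i')$ be two standard complexes. Then $\mathcal C\leq\mathcal C'$ in $\widehat{\mathfrak I}$ if and only if $(a_i,b_i)\leq(a_i',b_i')$ in the lexicographic order.
   Context: $\mathbb F$ is the field with two elements and $\mathbb F[U]$ is graded with $\deg U=-2$. Chain complexes over $\mathbb F[U]$ have $U$-equivariant differential $\partial$ of degree $-1$. For $\mathbb F[U]$-module maps, ''$f\in\operatorname{im}U$'' means that the image of $f$ is contained in $U\cdot(\text{target})$. Two grading-preserving $\mathbb F[U]$-module homomorphisms $f,g\colon C_1\to C_2$ between free, finitely generated, $\mathbb Z$-graded chain complexes over $\mathbb F[U]$ are homotopic mod $U$, written $f\simeq g \bmod U$, if there is an $\mathbb F[U]$-module homomorphism $H\colon C_1\to C_2$ raising grading by one with $f+g+H\partial+\partial H\in\operatorname{im}U$. An almost $\iota$-complex $\mathcal C=(C,\overline\iota)$ consists of a free, finitely generated, $\mathbb Z$-graded chain complex $C$ over $\mathbb F[U]$ with $U^{-1}H_*(C)\cong\mathbb F[U,U^{-1}]$ supported in even gradings, and a grading-preserving $\mathbb F[U]$-module homomorphism $\overline\iota\colon C\to C$ with $\overline\iota\partial+\partial\overline\iota\in\operatorname{im}U$ and $\overline\iota^2\simeq\mathrm{id}\bmod U$; gradings are normalized so that the maximal grading of a $U$-nontorsion homogeneous element of $H_*(C)$ is $0$. Write $\omega=1+\overline\iota$. An almost $\iota$-morphism $(C_1,\overline\iota_1)\to(C_2,\overline\iota_2)$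 is a grading-preserving, $U$-equivariant chain map $f$ with $f\overline\iota_1\simeq\overline\iota_2 f\bmod U$; it is a local map if it induces an isomorphism on $U^{-1}H_*$. Two almost $\iota$-complexes are locally equivalent if there are local maps in both directions; $\widehat{\mathfrak I}$ is the group of almost $\iota$-complexes modulo local equivalence, under tensor product. Its order is: $\mathcal C_1\leq\mathcal C_2$ if and only if there is a local map $\mathcal C_1\to\mathcal C_2$. Standard complexes: let $n\geq0$ and let $(a_i,b_i)=(a_1,b_2,a_3,b_4,\dots,a_{2n-1},b_{2n})$ with each $a_i\in\{-1,+1\}$ (also written $-,+$) and each $b_i\in\mathbb Z\setminus\{0\}$. The standard complex $\mathcal C(a_i,b_i)$ is freely generated over $\mathbb F[U]$ by $T_0,\dots,T_{2n}$, with: for each odd $i$, $\omega T_{i-1}=T_i$ if $a_i=-1$ and $\omega T_i=T_{i-1}$ if $a_i=+1$; for each even $i\geq2$, $\partial T_{i-1}=U^{|b_i|}T_i$ if $b_i<0$ and $\partial T_i=U^{|b_i|}T_{i-1}$ if $b_i>0$; all other values of $\omega$ and $\partial$ on generators are zero. The grading is determined by $\operatorname{gr}(T_0)=0$, $\deg\omega=0$, $\deg\partial=-1$. The length is $2n$. Lexicographic order: let $\mathbb Z^!$ be the set $\mathbb Z$ with the total order $-1<^!-2<^!-3<^!\cdots<^!0<^!\cdots<^!3<^!2<^!1$. Sequences are compared lexicographically using this order on entries; to compare sequences of different lengths, append trailing zeros to the shorter one. *)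

(* Defs.v *)
From HB Require Import structures.
From mathcomp Require Import all_boot all_order all_algebra.
From mathcomp Require Import generic_quotient ring_quotient boolp ring zify.

Set Implicit Arguments.
Unset Strict Implicit.
Unset Printing Implicit Defensive.

Import Order.TTheory GRing.Theory Num.Theory.
Local Open Scope ring_scope.
Local Open Scope quotient_scope.

Section QuotientModule.
Variables (R : comNzRingType) (V : lmodType R) (I : submodClosed V).

(* A submodClosed predicate is not canonically a zmodClosed one. *)
Definition lquot_pred : {pred V} := fun x => x \in I.

Fact lquot_pred_zmod_closed : zmod_closed lquot_pred.
Proof.
split=> [|x y xI yI]; first exact: (rpred0 I).
change (x - y \in I); rewrite -scaleN1r; apply: rpredD; first exact: xI.
by apply: rpredZ; exact: yI.
Qed.
HB.instance Definition _ := GRing.isZmodClosed.Build V lquot_pred lquot_pred_zmod_closed.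

Definition lquot : Type := @Quotient.quot V lquot_pred.
HB.instance Definition _ := GRing.Zmodule.on lquot.

Definition lquot_pi (x : V) : lquot := \pi_(@Quotient.quot V lquot_pred) x.
Definition lquot_repr (q : lquot) : V := repr (q : @Quotient.quot V lquot_pred).

Lemma lquot_reprK : cancel lquot_repr lquot_pi.
Proof. exact: reprK. Qed.

Lemma lquot_piP x y : lquot_pi x = lquot_pi y <-> x - y \in I.
Proof.
rewrite -[_ \in I]/(Quotient.equiv lquot_pred x y); split=> [/eqP|h]; first by rewrite /lquot_pi piE.
by apply/eqP; rewrite piE.
Qed.

Fact lquot_pi_is_additive : {morph lquot_pi : x y / x - y}.
Proof.
move=> x y; rewrite /lquot_pi (@Quotient.pi_add _ lquot_pred x (- y)).
by rewrite (@Quotient.pi_opp _ lquot_pred y).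
Qed.

HB.instance Definition _ :=
  GRing.isZmodMorphism.Build V lquot lquot_pi lquot_pi_is_additive.

Definition lquot_scale (a : R) (q : lquot) : lquot :=
  lquot_pi (a *: lquot_repr q).

Lemma lquot_pi_scale a x : lquot_scale a (lquot_pi x) = lquot_pi (a *: x).
Proof.
apply/lquot_piP; rewrite -scalerBr; apply: rpredZ.
by apply/lquot_piP; rewrite lquot_reprK.
Qed.

Fact lquot_scalerA a b v : lquot_scale a (lquot_scale b v) = lquot_scale (a * b) v.
Proof. by rewrite -[v]lquot_reprK !lquot_pi_scale scalerA. Qed.
Fact lquot_scale1r : left_id 1 lquot_scale.
Proof. by move=> v; rewrite -[v]lquot_reprK lquot_pi_scale scale1r. Qed.
Fact lquot_scalerDr : right_distributive lquot_scale +%R.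
Proof.
move=> a u v; rewrite -[u]lquot_reprK -[v]lquot_reprK -raddfD !lquot_pi_scale.
by rewrite scalerDr raddfD.
Qed.
Fact lquot_scalerDl v : {morph lquot_scale^~ v : a b / a + b}.
Proof.
by move=> a b; rewrite -[v]lquot_reprK !lquot_pi_scale scalerDl raddfD.
Qed.

HB.instance Definition _ := GRing.Zmodule_isLmodule.Build R lquot
  lquot_scalerA lquot_scale1r lquot_scalerDr lquot_scalerDl.

Fact lquot_pi_is_scalable : scalable lquot_pi.
Proof. by move=> a x; rewrite -lquot_pi_scale. Qed.

HB.instance Definition _ :=
  GRing.isScalable.Build R V lquot *:%R lquot_pi lquot_pi_is_scalable.

End QuotientModule.

(* The localization t^{-1} V; the pair (x, k) stands for the fraction t^{-k} x. *)
Section Localization.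
Variables (R : comNzRingType) (t : R) (V : lmodType R).

Definition loc_eqv (u v : V * nat) : bool :=
  `[< exists m, t ^+ m *: (t ^+ v.2 *: u.1 - t ^+ u.2 *: v.1) = 0 >].

Lemma loc_eqvP u v :
  reflect (exists m, t ^+ (m + v.2) *: u.1 = t ^+ (m + u.2) *: v.1) (loc_eqv u v).
Proof.
apply: (iffP (asboolP _)) => -[m h]; exists m.
  by apply/eqP; rewrite -subr_eq0 -h scalerBr !scalerA !exprD.
by rewrite scalerBr !scalerA -!exprD h subrr.
Qed.

Fact loc_eqv_equiv : equiv_class_of loc_eqv.
Proof.
split=> [u|u v|v u w].
- by apply/loc_eqvP; exists 0%N.
- by apply/loc_eqvP/loc_eqvP => -[m h]; exists m.
- move=> /loc_eqvP[m h] /loc_eqvP[n h']; apply/loc_eqvP; exists (m + n + v.2)%N.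
  have -> : (m + n + v.2 + w.2 = (n + w.2) + (m + v.2))%N by ring.
  rewrite exprD -scalerA h scalerA mulrC -scalerA h' scalerA -exprD.
  by congr (_ ^+ _ *: _); ring.
Qed.

Canonical loc_eqv_equivRel := EquivRelPack loc_eqv_equiv.
Canonical loc_eqv_encModRel := defaultEncModRel loc_eqv.

Definition loc : Type := {eq_quot loc_eqv}.
HB.instance Definition _ := Choice.on loc.

Definition frac (x : V) (k : nat) : loc := \pi_({eq_quot loc_eqv}) (x, k).
Definition loc_repr (z : loc) : V * nat := repr (z : {eq_quot loc_eqv}).

Lemma loc_reprK z : frac (loc_repr z).1 (loc_repr z).2 = z.
Proof. by rewrite /frac -surjective_pairing; apply: reprK. Qed.

Lemma fracP x k y l :
  frac x k = frac y l <-> exists m, t ^+ (m + l) *: x = t ^+ (m + k) *: y.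
Proof.
split=> [/eqP|h]; first by rewrite /frac piE => /loc_eqvP.
by apply/eqP; rewrite /frac piE; apply/loc_eqvP.
Qed.

Lemma fracW z : exists x k, z = frac x k.
Proof. by exists (loc_repr z).1, (loc_repr z).2; rewrite loc_reprK. Qed.

Lemma fracUl m x k : frac (t ^+ m *: x) (m + k) = frac x k.
Proof. by apply/fracP; exists 0%N; rewrite !add0n scalerA -exprD addnC. Qed.

Lemma fracC m x k y l :
  t ^+ (m + l) *: x = t ^+ (m + k) *: y -> frac x k = frac y l.
Proof. by move=> h; apply/fracP; exists m. Qed.

Definition loc_add (z w : loc) : loc :=
  let: (x, k) := loc_repr z in
  let: (y, l) := loc_repr w in
  frac (t ^+ l *: x + t ^+ k *: y) (k + l).
Definition loc_opp (z : loc) : loc := frac (- (loc_repr z).1) (loc_repr z).2.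
Definition loc_scale (a : R) (z : loc) : loc :=
  frac (a *: (loc_repr z).1) (loc_repr z).2.

Lemma loc_addE x k y l :
  loc_add (frac x k) (frac y l) = frac (t ^+ l *: x + t ^+ k *: y) (k + l).
Proof.
rewrite /loc_add; move: (loc_reprK (frac x k)) (loc_reprK (frac y l)).
case: (loc_repr _) => x' k'; case: (loc_repr _) => y' l' /=.
move=> /fracP[m h] /fracP[n h']; apply/fracP; exists (m + n)%N.
rewrite !scalerDr !scalerA -!exprD.
have -> : (m + n + (k + l) + l' = (n + l + l') + (m + k))%N by ring.
have -> : (m + n + (k + l) + k' = (m + k + k') + (n + l))%N by ring.
rewrite [in LHS]exprD -scalerA h [t ^+ (m + k + k' + _)]exprD -scalerA h'.
rewrite !scalerA -!exprD; congr (t ^+ _ *: _ + t ^+ _ *: _); ring.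
Qed.

Lemma loc_oppE x k : loc_opp (frac x k) = frac (- x) k.
Proof.
rewrite /loc_opp; have /fracP[m h] := loc_reprK (frac x k).
by apply: (@fracC m); rewrite !scalerN h.
Qed.

Lemma loc_scaleE a x k : loc_scale a (frac x k) = frac (a *: x) k.
Proof.
rewrite /loc_scale; have /fracP[m h] := loc_reprK (frac x k).
apply: (@fracC m); rewrite !scalerA ![_ * a]mulrC -!scalerA; congr (_ *: _).
exact: h.
Qed.

Fact loc_addA : associative loc_add.
Proof.
move=> u v w; have [x [k ->]] := fracW u; have [y [l ->]] := fracW v.
have [z [m ->]] := fracW w; rewrite !loc_addE addnA; congr frac.
rewrite !scalerDr !scalerA -!exprD addrA.
by congr (t ^+ _ *: _ + t ^+ _ *: _ + _); ring.
Qed.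
Fact loc_addC : commutative loc_add.
Proof.
move=> u v; have [x [k ->]] := fracW u; have [y [l ->]] := fracW v.
by rewrite !loc_addE addrC addnC.
Qed.
Fact loc_add0 : left_id (frac 0 0) loc_add.
Proof.
move=> u; have [x [k ->]] := fracW u.
by rewrite loc_addE scaler0 add0r expr0 scale1r add0n.
Qed.
Fact loc_addN : left_inverse (frac 0 0) loc_opp loc_add.
Proof.
move=> u; have [x [k ->]] := fracW u.
rewrite loc_oppE loc_addE scalerN addNr.
by apply: (@fracC 0); rewrite !scaler0.
Qed.
HB.instance Definition _ :=
  GRing.isZmodule.Build loc loc_addA loc_addC loc_add0 loc_addN.

Lemma fracD x k y l :
  frac x k + frac y l = frac (t ^+ l *: x + t ^+ k *: y) (k + l).
Proof. exact: loc_addE. Qed.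
Lemma frac0 k : frac 0 k = 0.
Proof. by apply: (@fracC 0); rewrite !scaler0. Qed.

Lemma fracDl k x y : frac (x + y) k = frac x k + frac y k.
Proof. by rewrite fracD -scalerDr fracUl. Qed.

Fact loc_scalerA a b z : loc_scale a (loc_scale b z) = loc_scale (a * b) z.
Proof. by have [x [k ->]] := fracW z; rewrite !loc_scaleE scalerA. Qed.
Fact loc_scale1r : left_id 1 loc_scale.
Proof. by move=> z; have [x [k ->]] := fracW z; rewrite loc_scaleE scale1r. Qed.
Fact loc_scalerDr : right_distributive loc_scale +%R.
Proof.
move=> a u v; have [x [k ->]] := fracW u; have [y [l ->]] := fracW v.
rewrite fracD !loc_scaleE fracD scalerDr !scalerA.
by rewrite ![a * _]mulrC.
Qed.
Fact loc_scalerDl z : {morph loc_scale^~ z : a b / a + b}.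
Proof.
by move=> a b; have [x [k ->]] := fracW z; rewrite !loc_scaleE scalerDl fracDl.
Qed.
HB.instance Definition _ := GRing.Zmodule_isLmodule.Build R loc
  loc_scalerA loc_scale1r loc_scalerDr loc_scalerDl.

Lemma fracZ a x k : a *: frac x k = frac (a *: x) k.
Proof. exact: loc_scaleE. Qed.

Lemma frac_eq0 x k : frac x k = 0 <-> exists m, t ^+ m *: x = 0.
Proof.
rewrite -(frac0 0); split=> [/fracP[m]|[m h]]; last first.
  by apply: (@fracC m); rewrite addn0 h scaler0.
by rewrite addn0 scaler0; exists m.
Qed.

End Localization.

Section LocalizedMap.
Variables (R : comNzRingType) (t : R) (V W : lmodType R) (g : {linear V -> W}).

Definition loc_map (z : loc t V) : loc t W := frac t (g (loc_repr z).1) (loc_repr z).2.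

Lemma loc_mapE x k : loc_map (frac t x k) = frac t (g x) k.
Proof.
rewrite /loc_map; have /fracP[m h] := loc_reprK (frac t x k).
by apply: (@fracC _ _ _ m); rewrite -!linearZ h.
Qed.

Fact loc_map_is_linear : linear loc_map.
Proof.
move=> a u v; have [x [k ->]] := fracW u; have [y [l ->]] := fracW v.
rewrite fracZ fracD !loc_mapE fracZ fracD; congr frac.
by rewrite linearD ![g (_ *: _)]linearZ_LR.
Qed.
HB.instance Definition _ :=
  GRing.isLinear.Build R (loc t V) (loc t W) *:%R loc_map loc_map_is_linear.

End LocalizedMap.

Notation F2U := {poly 'F_2}.
Notation U := ('X : F2U).

(* A free finitely generated graded module is given by a homogeneous basis: it
   is the module of row vectors over F2[U], with grading gr i for the i-th
   basis vector, so that U^k times that vector has degree gr i - 2k. *)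
Definition homog n (gr : 'I_n -> int) (d : int) (x : 'rV[F2U]_n) : Prop :=
  forall i k, (x 0 i)`_k != 0 -> gr i - (2 * k)%:Z = d.

Definition has_degree m n (gr : 'I_m -> int) (gr' : 'I_n -> int) (e : int)
    (f : 'rV[F2U]_m -> 'rV[F2U]_n) : Prop :=
  forall d x, homog gr d x -> homog gr' (d + e) (f x).

Record gcomplex := GComplex {
  rk : nat;
  gr : 'I_rk -> int;
  bd : {linear 'rV[F2U]_rk -> 'rV[F2U]_rk};
  bd_degree : has_degree gr gr (-1) bd;
  bd_bd : forall x, bd (bd x) = 0
}.

Arguments gr : clear implicits.

Notation chains C := 'rV[F2U]_(rk C).

Section Homology.
Variable C : gcomplex.

Definition is_cycle : {pred chains C} := fun x => bd C x == 0.

Fact is_cycle_submod_closed : subsemimod_closed is_cycle.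
Proof.
split=> [|a x]; last first.
  by rewrite !unfold_in linearZ_LR => /eqP->; rewrite scaler0.
split=> [|x y]; rewrite !unfold_in ?linear0 // linearD.
by move=> /eqP-> /eqP->; rewrite addr0.
Qed.
HB.instance Definition _ :=
  GRing.isSubmodClosed.Build F2U (chains C) is_cycle is_cycle_submod_closed.

Record cycle := Cycle { cycle_val : chains C; _ : cycle_val \in is_cycle }.
HB.instance Definition _ := [isSub of cycle for cycle_val].
HB.instance Definition _ := [Choice of cycle by <:].
HB.instance Definition _ := [SubChoice_isSubZmodule of cycle by <:].
HB.instance Definition _ := [SubZmodule_isSubLmodule of cycle by <:].

Lemma cycleP (x : cycle) : bd C (val x) = 0.
Proof. by apply/eqP; have := valP x; rewrite unfold_in. Qed.

Definition is_boundary : {pred cycle} := fun x => `[< exists y, bd C y = val x >].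

Lemma is_boundaryP (x : cycle) :
  reflect (exists y, bd C y = val x) (x \in is_boundary).
Proof. by rewrite unfold_in; apply: asboolP. Qed.

Fact is_boundary_submod_closed : subsemimod_closed is_boundary.
Proof.
split=> [|a x /is_boundaryP[y hy]]; last first.
  by apply/is_boundaryP; exists (a *: y); rewrite linearZ_LR hy.
split=> [|x x' /is_boundaryP[y hy] /is_boundaryP[y' hy']]; apply/is_boundaryP.
  by exists 0; rewrite linear0.
by exists (y + y'); rewrite linearD hy hy'.
Qed.
HB.instance Definition _ :=
  GRing.isSubmodClosed.Build F2U cycle is_boundary is_boundary_submod_closed.

Definition homology : lmodType F2U := lquot is_boundary.
Definition hclass (x : cycle) : homology := lquot_pi is_boundary x.

Lemma hclassP (x y : cycle) :
  hclass x = hclass y <-> exists z, bd C z = val x - val y.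
Proof.
split=> [/lquot_piP/is_boundaryP[z]|[z hz]]; first by exists z.
by apply/lquot_piP/is_boundaryP; exists z.
Qed.

Lemma hclassW (c : homology) : exists x, c = hclass x.
Proof. by exists (lquot_repr c); rewrite /hclass lquot_reprK. Qed.

Definition hhomog (d : int) (c : homology) : Prop :=
  exists2 x : cycle, homog (gr C) d (val x) & c = hclass x.

(* U^{-1} H_*(C); the grading of a fraction U^{-k} c is that of c plus 2k. *)
Definition loc_homology : lmodType F2U := loc U homology.

Definition loc_hhomog (d : int) (z : loc_homology) : Prop :=
  exists c k, hhomog (d - (2 * k)%:Z) c /\ z = frac U c k.

End Homology.

(* F2[U, U^{-1}] *)
Definition laurent : lmodType F2U := loc U (F2U^o : lmodType F2U).

Record chain_map (C1 C2 : gcomplex) := ChainMap {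
  cmap :> {linear chains C1 -> chains C2};
  cmap_degree : has_degree (gr C1) (gr C2) 0 cmap;
  cmap_bd : forall x, cmap (bd C1 x) = bd C2 (cmap x)
}.

Section InducedMap.
Variables (C1 C2 : gcomplex) (f : chain_map C1 C2).

Fact cycle_map_subproof (x : cycle C1) : f (val x) \in @is_cycle C2.
Proof. by rewrite unfold_in -cmap_bd cycleP linear0. Qed.

Definition cycle_map (x : cycle C1) : cycle C2 := Cycle (cycle_map_subproof x).

Definition homology_map (c : homology C1) : homology C2 :=
  hclass (cycle_map (lquot_repr c)).

Lemma homology_mapE x : homology_map (hclass x) = hclass (cycle_map x).
Proof.
have /hclassP[z hz] : hclass (lquot_repr (hclass x)) = hclass x.
  by rewrite /hclass lquot_reprK.
by apply/hclassP; exists (f z); rewrite -cmap_bd hz linearB.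
Qed.

Fact homology_map_is_linear : linear homology_map.
Proof.
move=> a u v; have [x ->] := hclassW u; have [y ->] := hclassW v.
rewrite /hclass -linearP -!/(hclass _) !homology_mapE /hclass -linearP.
by congr lquot_pi; apply: val_inj; rewrite /= linearP.
Qed.
HB.instance Definition _ := GRing.isLinear.Build F2U (homology C1) (homology C2)
  *:%R homology_map homology_map_is_linear.

Definition loc_homology_map : loc_homology C1 -> loc_homology C2 :=
  loc_map homology_map.

End InducedMap.

Definition in_imU (V W : lmodType F2U) (f : V -> W) : Prop :=
  forall x, exists y, f x = U *: y.

Definition homotopic_modU (C1 C2 : gcomplex) (f g : {linear chains C1 -> chains C2}) : Prop :=
  exists2 H : {linear chains C1 -> chains C2},
    has_degree (gr C1) (gr C2) 1 H &
    in_imU (fun x => f x + g x + H (bd C1 x) + bd C2 (H x)).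

Definition U_nontorsion (V : lmodType F2U) (x : V) : Prop :=
  forall k, U ^+ k *: x != 0.

Record almost_iota := AlmostIota {
  cx :> gcomplex;
  iotabar : {linear chains cx -> chains cx};
  (* F2[U]-linearity gives F2[U, U^{-1}]-linearity, as U acts invertibly. *)
  tower : exists phi : {linear laurent -> loc_homology cx}, bijective phi;
  even_tower : forall d (z : loc_homology cx), loc_hhomog d z -> z != 0 -> (2 %| d)%Z;
  max_grading_attained : exists2 c : homology cx, hhomog 0 c & U_nontorsion c;
  max_grading_ub : forall d (c : homology cx), hhomog d c -> U_nontorsion c -> d <= 0;
  iotabar_degree : has_degree (gr cx) (gr cx) 0 iotabar;
  iotabar_bd : in_imU (fun x => iotabar (bd cx x) + bd cx (iotabar x));
  iotabar_sq : homotopic_modU (iotabar \o iotabar) idfun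
}.

Record ai_morphism (A B : almost_iota) := AIMorphism {
  ai_map :> chain_map A B;
  ai_map_iota : homotopic_modU (ai_map \o iotabar A) (iotabar B \o ai_map)
}.

Definition is_local (A B : almost_iota) (f : ai_morphism A B) : Prop :=
  bijective (loc_homology_map f).

Definition ai_le (A B : almost_iota) : Prop :=
  exists f : ai_morphism A B, is_local f.

(* The parameter sequence (a_1, b_2, a_3, ..., a_{2n-1}, b_{2n}) as a list.
   Lists are indexed from 0, so a_i or b_i is entries`_(i - 1): the a's sit at
   even positions of the list and the b's at odd ones. *)
Record std_seq := StdSeq {
  entries :> seq int;
  std_size : ~~ odd (size entries);
  std_a : forall i, (i < size entries)%N -> ~~ odd i -> entries`_i \in [:: -1; 1];
  std_b : forall i, (i < size entries)%N -> odd i -> entries`_i != 0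
}.

Definition lin_ext m n (g : nat -> 'rV[F2U]_n) : {linear 'rV[F2U]_m -> 'rV[F2U]_n} :=
  mulmxr (\matrix_(i < m) g i).

Section StandardComplex.
Variable s : std_seq.
Let N := (size s).+1.

(* Past the end of the list s`_i is 0, so only T 0, ..., T (size s) occur. *)
Definition T (i : nat) : 'rV[F2U]_N := \row_(j < N) (j == i :> nat)%:R.

Definition std_omega_gen (i : nat) : 'rV[F2U]_N :=
  if odd i then (if s`_i.-1 == 1 then T i.-1 else 0)
  else (if s`_i == -1 then T i.+1 else 0).

Definition std_bd_gen (i : nat) : 'rV[F2U]_N :=
  if odd i then (if s`_i < 0 then U ^+ absz s`_i *: T i.+1 else 0)
  else (if (0 < i)%N && (0 < s`_i.-1) then U ^+ absz s`_i.-1 *: T i.-1 else 0).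

(* For even i >= 2, both rules for the differential say
   gr T_i = gr T_{i-1} + sgn b_i - 2 b_i. *)
Definition std_gr (i : 'I_N) : int :=
  \sum_(0 <= k < i | odd k) (sgz s`_k - 2 * s`_k).

(* omega = 1 + iota, hence iota = 1 + omega in characteristic 2. *)
Definition std_omega := lin_ext N std_omega_gen.
Definition std_bd := lin_ext N std_bd_gen.
Definition std_iota : {linear 'rV[F2U]_N -> 'rV[F2U]_N} := idfun \+ std_omega.

End StandardComplex.

Lemma lin_extE m n (g : nat -> 'rV[F2U]_n) (x : 'rV[F2U]_m) :
  lin_ext m g x = \sum_(i < m) x 0 i *: g i.
Proof.
rewrite /lin_ext /= mulmx_sum_row; apply: eq_bigr => i _.
by rewrite rowK.
Qed.

Lemma homog0 n (gr : 'I_n -> int) d : homog gr d 0.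
Proof. by move=> i k; rewrite mxE coef0 eqxx. Qed.

Lemma homogD n (gr : 'I_n -> int) d x y :
  homog gr d x -> homog gr d y -> homog gr d (x + y).
Proof.
move=> hx hy i k; rewrite mxE coefD; have [x0|/hx //] := eqVneq (x 0 i)`_k 0.
by rewrite x0 add0r => /hy.
Qed.

Lemma homogZ n (gr : 'I_n -> int) (p : F2U) c d v :
  (forall k, p`_k != 0 -> c - (2 * k)%:Z = d) -> homog gr c v -> homog gr d (p *: v).
Proof.
move=> hp hv i m; rewrite mxE coefM => nz.
have [k /andP[pk vk]] : exists k : 'I_m.+1, (p`_k != 0) && ((v 0 i)`_(m - k) != 0).
  apply/existsP; apply: contraNT nz; rewrite negb_exists => /forallP h.
  by apply/eqP/big1 => k _; apply/eqP; rewrite mulf_eq0 -[_ || _]negbK negb_or h.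
have := hp _ pk; have := hv _ _ vk; have := ltn_ord k; lia.
Qed.

Lemma lin_ext_degree m n (gr : 'I_m -> int) (gr' : 'I_n -> int) (e : int) (g : nat -> 'rV[F2U]_n) :
  (forall i : 'I_m, homog gr' (gr i + e) (g i)) -> has_degree gr gr' e (lin_ext m g).
Proof.
move=> hg d x hx; rewrite lin_extE; elim/big_ind: _ => [|y z|i _].
- exact: homog0.
- exact: homogD.
- by apply: (homogZ _ (hg i)) => k /hx; lia.
Qed.

Section StandardComplexTheory.
Variable s : std_seq.
Let N := (size s).+1.
Local Notation T := (T s).

Lemma homogT (i : 'I_N) : homog (@std_gr s) (std_gr i) (T i).
Proof.
move=> j k; rewrite mxE; have [ji|_] := nat_of_ord j =P i; last by rewrite mulr0n coef0 eqxx.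
have -> : j = i by apply: val_inj.
by rewrite mulr1n coef1; case: k => [|k] //=; rewrite ?subr0 // eqxx.
Qed.

Lemma homogUT (i : 'I_N) b (d : int) : std_gr i - (2 * b)%:Z = d ->
  homog (@std_gr s) d (U ^+ b *: T i).
Proof.
move=> hd; apply: (homogZ _ (@homogT i)) => k; rewrite coefXn.
by have [-> //|_] := k =P b; rewrite eqxx.
Qed.

Lemma std_grS (i j : 'I_N) : j = i.+1 :> nat ->
  std_gr j = std_gr i + (if odd i then sgz s`_i - 2 * s`_i else 0).
Proof.
rewrite /std_gr => ->; rewrite big_mkcond big_nat_recr //= -big_mkcond.
by [].
Qed.

Lemma lin_extT n (g : nat -> 'rV[F2U]_n) i : (i < N)%N -> lin_ext N g (T i) = g i.
Proof.
move=> iN; rewrite lin_extE (bigD1 (Ordinal iN)) //= big1 => [|j].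
  by rewrite mxE eqxx scale1r addr0.
by rewrite -val_eqE /= mxE => /negbTE->; rewrite scale0r.
Qed.

Lemma sumT (x : 'rV[F2U]_N) : x = \sum_i x 0 i *: T i.
Proof.
apply/rowP => j; rewrite summxE (bigD1 j) //= !mxE eqxx mulr1 big1 ?addr0 // => i.
by rewrite -val_eqE /= !mxE eq_sym => /negbTE->; rewrite mulr0.
Qed.

Lemma linT n (f g : {linear 'rV[F2U]_N -> 'rV[F2U]_n}) :
  (forall i, (i < N)%N -> f (T i) = g (T i)) -> f =1 g.
Proof.
move=> fg x; rewrite [x]sumT !linear_sum; apply: eq_bigr => i _.
by rewrite !linearZ_LR fg.
Qed.

Lemma odd_lt i : (i < N)%N -> odd i -> (i.+1 < N)%N.
Proof.
rewrite !ltnS leq_eqVlt => /predU1P[->|//].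
by have := std_size s => /negbTE->.
Qed.

Lemma std_bd_degree : has_degree (@std_gr s) (@std_gr s) (-1) (std_bd s).
Proof.
apply: lin_ext_degree => -[[|i] iN] /=; rewrite /std_bd_gen /=; first exact: homog0.
case: ifP => oi; case: ifP => si; try exact: homog0.
  have jN := odd_lt iN oi.
  apply: (@homogUT (Ordinal jN)); rewrite (@std_grS (Ordinal iN)) //= oi.
  by rewrite (ltr0_sgz si); move: (std_gr _) => g; lia.
have jN : (i < N)%N by apply: ltnW.
apply: (@homogUT (Ordinal jN)); rewrite (@std_grS (Ordinal jN) (Ordinal iN)) //=.
rewrite -[odd i]negbK oi /= gtr0_sgz //; move: (std_gr _) => g; lia.
Qed.

Lemma std_omega_degree : has_degree (@std_gr s) (@std_gr s) 0 (std_omega s).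
Proof.
apply: lin_ext_degree => -[i iN] /=; rewrite /std_omega_gen addr0.
case: ifP => oi; case: ifP => si; try exact: homog0.
  case: i iN oi si => //= i iN oi si; have jN : (i < N)%N by apply: ltnW.
  rewrite (@std_grS (Ordinal jN) (Ordinal iN)) //= (negbTE oi) addr0.
  exact: (@homogT (Ordinal jN)).
have jN : (i.+1 < N)%N.
  rewrite ltnS ltnNge; apply/negP => h; move: si; rewrite nth_default //.
have := @std_grS (Ordinal iN) (Ordinal jN) erefl; rewrite /= oi addr0 => <-.
exact: (@homogT (Ordinal jN)).
Qed.

Lemma lin_ext0 m n (x : 'rV[F2U]_m) : lin_ext m (fun=> 0 : 'rV[F2U]_n) x = 0.
Proof. by rewrite lin_extE big1 // => i _; rewrite scaler0. Qed.

Lemma std_bdT i : (i < N)%N -> std_bd s (T i) = std_bd_gen s i.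
Proof. exact: lin_extT. Qed.

Lemma std_bd_bd x : std_bd s (std_bd s x) = 0.
Proof.
apply: (linT (f := std_bd s \o std_bd s) (g := \0)) => i iN.
change (std_bd s (std_bd s (T i)) = 0); rewrite std_bdT //.
rewrite {1}/std_bd_gen; case: ifP => oi; case: ifP => si; rewrite ?linear0 //.
  rewrite linearZ_LR std_bdT ?odd_lt // /std_bd_gen /= oi /= ltNge ltW //=.
  by rewrite scaler0.
case: i iN oi si => [|i] iN // oi si; rewrite /= in oi si.
rewrite linearZ_LR (std_bdT (ltnW iN)) /std_bd_gen -[odd i]negbK oi /=.
by rewrite ltNge ltW //= scaler0.
Qed.

Definition std_gcomplex : gcomplex := GComplex std_bd_degree std_bd_bd.

(* Multiplication by U^m, minus its T_0-component, is nullhomotopic. *)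
Let m : nat := (\sum_(0 <= k < size s) absz (s`_k)%R)%N.

Lemma std_le_m i : (absz (s`_i)%R <= m)%N.
Proof.
have [h|h] := ltnP i (size s); last by rewrite nth_default.
by rewrite /m big_mkord (bigD1 (Ordinal h)) //= leq_addr.
Qed.

Definition std_K_gen (i : nat) : 'rV[F2U]_N :=
  if odd i then (if 0 < s`_i then U ^+ (m - absz s`_i) *: T i.+1 else 0)
  else (if (0 < i)%N && (s`_i.-1 < 0) then U ^+ (m - absz s`_i.-1) *: T i.-1 else 0).
Definition std_K := lin_ext N std_K_gen.

Lemma std_KT i : (i < N)%N -> std_K (T i) = std_K_gen i.
Proof. exact: lin_extT. Qed.

Lemma std_bd_K x :
  std_bd s (std_K x) + std_K (std_bd s x) = U ^+ m *: (x - x 0 0 *: T 0).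
Proof.
pose h := lin_ext N (fun i => if i == 0%N then 0 else U ^+ m *: T i).
transitivity (h x).
  apply: (linT (f := (std_bd s \o std_K) \+ (std_K \o std_bd s)) (g := h)).
  move=> i iN; change (std_bd s (std_K (T i)) + std_K (std_bd s (T i)) = h (T i)).
  rewrite std_bdT // std_KT // [h _]lin_extT //.
  rewrite /std_bd_gen /std_K_gen; case: ifP => oi.
    have -> : (i == 0%N) = false by case: i oi {iN}.
    have iS := odd_lt iN oi.
    have si : s`_i != 0 by apply: std_b => //; rewrite -ltnS.
    case: (ltrgt0P s`_i) => hs; last by rewrite hs eqxx in si.
      rewrite linear0 addr0 linearZ_LR std_bdT // /std_bd_gen /= oi /= hs scalerA.
      by rewrite -exprD subnK ?std_le_m.
    rewrite linear0 add0r linearZ_LR std_KT // /std_K_gen /= oi /= hs scalerA.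
    by rewrite -exprD subnKC ?std_le_m.
  case: i iN oi => [|i] iN oi; first by rewrite !linear0 addr0.
  rewrite [(i.+1 == 0)%N]/= [i.+1.-1]/=; rewrite /= in oi.
  have {}oi : odd i by apply: negbFE.
  rewrite ltn0Sn !andTb.
  have iN' := ltnW iN; have si : s`_i != 0 by apply: std_b => //; rewrite -ltnS.
  case: (ltrgt0P s`_i) => hs; last by rewrite hs eqxx in si.
    rewrite linear0 add0r linearZ_LR std_KT // /std_K_gen /= oi /= hs scalerA.
    by rewrite -exprD subnKC ?std_le_m.
  rewrite linear0 addr0 linearZ_LR std_bdT // /std_bd_gen /= oi /= hs scalerA.
  by rewrite -exprD subnK ?std_le_m.
have -> : x - x 0 0 *: T 0 =
    \sum_(i < size s) x 0 (lift ord0 i) *: T (lift ord0 i).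
  by rewrite {1}[x]sumT big_ord_recl addrAC subrr add0r.
rewrite lin_extE big_ord_recl scaler0 add0r scaler_sumr; apply: eq_bigr => i _.
by rewrite !scalerA mulrC.
Qed.

Lemma std_bd00 x : (std_bd s x) 0 0 = 0.
Proof.
rewrite [std_bd s x]lin_extE summxE big1 // => -[i iN] _; rewrite mxE /std_bd_gen /=.
case: ifP => oi; case: ifP => si; rewrite !mxE /= ?mulr0 //.
by case: i iN oi si => [|[|i]] //= iN oi si; rewrite !mulr0.
Qed.

Lemma std_T0_cycle : T 0 \in @is_cycle std_gcomplex.
Proof. by rewrite unfold_in; apply/eqP; exact: (@std_bdT 0). Qed.
Definition std_T0 : cycle std_gcomplex := Cycle std_T0_cycle.

Lemma std_hclass (x : cycle std_gcomplex) :
  U ^+ m *: hclass x = (U ^+ m * (val x : 'rV_N) 0 0) *: hclass std_T0.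
Proof.
rewrite /hclass -!linearZ_LR -!/(hclass _); apply/hclassP.
exists (std_K (val x)); have := std_bd_K (val x).
have -> : std_bd s (val x) = 0 by exact: (@cycleP std_gcomplex x).
by rewrite linear0 addr0 scalerBr scalerA.
Qed.

Lemma std_hclass0 (r : F2U) : r *: hclass std_T0 = 0 -> r = 0.
Proof.
rewrite -(linear0 (lquot_pi (@is_boundary std_gcomplex))).
rewrite /hclass -linearZ_LR -!/(hclass _) => /hclassP[z hz].
have := std_bd00 z; rewrite [std_bd s z]hz subr0 /= !mxE mulr1.
by [].
Qed.

Definition std_tower_map (r : F2U^o) : homology std_gcomplex := r *: hclass std_T0.
Fact std_tower_map_is_linear : linear std_tower_map.
Proof. by move=> a x y; rewrite /std_tower_map scalerDl scalerA. Qed.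
HB.instance Definition _ := GRing.isLinear.Build F2U F2U^o (homology std_gcomplex)
  *:%R std_tower_map std_tower_map_is_linear.

Lemma Um_neq0 k : U ^+ k != 0.
Proof. by rewrite expf_neq0 ?polyX_eq0. Qed.

Lemma std_tower :
  exists phi : {linear laurent -> loc_homology std_gcomplex}, bijective phi.
Proof.
pose phi : {linear laurent -> loc_homology std_gcomplex} :=
  loc_map (t := U) std_tower_map.
exists phi.
have phi_inj : injective phi.
  apply: raddf_inj => z; have [r [k ->]] := fracW z.
  rewrite /phi /= loc_mapE => /frac_eq0[l].
  rewrite /std_tower_map scalerA => /std_hclass0 h.
  by apply/frac_eq0; exists l.
have phi_surj z : exists w, phi w = z.
  have [c [k ->]] := fracW z; have [x ->] := hclassW c.
  exists (frac U (U ^+ m * (val x : 'rV_N) 0 0 : F2U^o) (m + k)).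
  rewrite -(fracUl U m (hclass x) k) std_hclass; exact: loc_mapE.
have [psi hpsi] := choice phi_surj.
by exists psi => // w; apply: phi_inj.
Qed.

Lemma std_gr0 : std_gr (ord0 : 'I_N) = 0.
Proof. by rewrite /std_gr big_geq. Qed.

Lemma std_hhomog d (c : homology std_gcomplex) : hhomog d c ->
  (exists j : nat, d = - (2 * j)%:Z) \/ U ^+ m *: c = 0.
Proof.
case=> x hx ->; have [x0|nz] := eqVneq ((val x : 'rV_N) 0 0) 0.
  by right; rewrite std_hclass x0 mulr0 scale0r.
left; exists (size ((val x : 'rV_N) 0 0)).-1.
have := hx ord0 (size ((val x : 'rV_N) 0 0)).-1.
by rewrite -lead_coefE lead_coef_eq0 => /(_ nz) <-; rewrite [gr _ _]std_gr0 sub0r.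
Qed.

Lemma std_even_tower d (z : loc_homology std_gcomplex) :
  loc_hhomog d z -> z != 0 -> (2 %| d)%Z.
Proof.
move=> [c [k [/std_hhomog hc ->]]] nz; case: hc => [[j hj]|h]; last first.
  by case/eqP: nz; apply/frac_eq0; exists m.
have -> : d = (k%:Z - j%:Z) * 2 by move: hj; lia.
exact: dvdz_mull.
Qed.

Lemma std_max_attained :
  exists2 c : homology std_gcomplex, hhomog 0 c & U_nontorsion c.
Proof.
exists (hclass std_T0); first exists std_T0 => //.
  by rewrite -std_gr0; exact: (@homogT ord0).
by move=> k; apply/eqP => /std_hclass0/eqP; apply/negP/Um_neq0.
Qed.

Lemma std_max_ub d (c : homology std_gcomplex) :
  hhomog d c -> U_nontorsion c -> d <= 0.
Proof.
move=> /std_hhomog[[j ->] _|h /(_ m)/eqP //]; lia.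
Qed.

Lemma std_iota_degree : has_degree (gr std_gcomplex) (gr std_gcomplex) 0 (std_iota s).
Proof.
move=> d x hx; apply: homogD; first by rewrite addr0.
exact: std_omega_degree.
Qed.

Lemma std_bd_imU (x : 'rV[F2U]_N) : exists y : 'rV[F2U]_N, std_bd s x = U *: y.
Proof.
rewrite [std_bd s x]lin_extE; elim/big_ind: _ => [|_ _ [y ->] [z ->]|i _].
- by exists 0; rewrite scaler0.
- by exists (y + z); rewrite scalerDr.
suff [y ->] : exists y, std_bd_gen s i = U *: y.
  by exists (x 0 i *: y); rewrite !scalerA mulrC.
rewrite /std_bd_gen; case: ifP => _; case: ifP => si; try by exists 0; rewrite scaler0.
  exists (U ^+ (absz s`_i).-1 *: T i.+1); rewrite scalerA -exprS prednK // absz_gt0.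
  by rewrite lt_eqF.
case/andP: si => _ si.
exists (U ^+ (absz s`_i.-1).-1 *: T i.-1); rewrite scalerA -exprS prednK // absz_gt0.
by rewrite gt_eqF.
Qed.

Lemma char2 (x : 'rV[F2U]_N) : x + x = 0.
Proof.
apply/rowP => i; rewrite !mxE; apply/polyP => k; rewrite coefD coef0.
by rewrite -mulr2n -mulr_natr (_ : 2%:R = 0 :> 'F_2) ?mulr0 //; apply/val_inj.
Qed.

Lemma std_iota_bd : in_imU (fun x : chains std_gcomplex =>
  std_iota s (bd std_gcomplex x) + bd std_gcomplex (std_iota s x)).
Proof.
move=> x; have [y hy] := std_bd_imU x; have [z hz] := std_bd_imU (std_iota s x).
exists (std_iota s y + z : chains std_gcomplex).
by rewrite [bd _ x]hy [bd _ (_ x)]hz linearZ_LR !scalerDr.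
Qed.

Lemma std_omegaT i : (i < N)%N -> std_omega s (T i) = std_omega_gen s i.
Proof. exact: lin_extT. Qed.

Lemma std_omega_sq x : std_omega s (std_omega s x) = 0.
Proof.
apply: (linT (f := std_omega s \o std_omega s) (g := \0)) => i iN.
change (std_omega s (std_omega s (T i)) = 0); rewrite std_omegaT // {1}/std_omega_gen.
case: ifP => oi; case: ifP => si; rewrite ?linear0 //.
  case: i iN oi si => [|i] iN // oi /eqP si; rewrite /= in oi si.
  by rewrite (std_omegaT (ltnW iN)) /std_omega_gen (negbTE oi) si.
have jN : (i.+1 < N)%N.
  by rewrite ltnS ltnNge; apply/negP => h; move: si; rewrite nth_default.
by rewrite std_omegaT // /std_omega_gen /= oi /= (eqP si).
Qed.

Lemma std_iota_sq :
  homotopic_modU (C1 := std_gcomplex) (C2 := std_gcomplex)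
    (std_iota s \o std_iota s) idfun.
Proof.
exists \0 => [d x _|x]; first exact: homog0.
exists 0.
change (std_iota s (std_iota s x) + x + 0 + std_bd s 0 = 'X *: (0 : 'rV_N)).
have iotaE y : std_iota s y = y + std_omega s y by [].
rewrite linear0 scaler0 !addr0 !iotaE linearD std_omega_sq addr0.
by rewrite -[x + _ + _]addrA char2 addr0 char2.
Qed.

Definition std_complex : almost_iota :=
  AlmostIota std_tower std_even_tower std_max_attained std_max_ub
    std_iota_degree std_iota_bd std_iota_sq.

End StandardComplexTheory.

(* The strict order of Z^!: -1 < -2 < -3 < ... < 0 < ... < 3 < 2 < 1. *)
Definition lt_bang (x y : int) : bool :=
  if x < 0 then (y < 0) ==> (y < x)
  else (0 < y) && ((x == 0) || (y < x)).

(* Out of range s`_i is 0, which pads the shorter sequence with zeros. *)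
Definition lex_le (s s' : seq int) : Prop :=
  (forall i, s`_i = s'`_i) \/
  (exists i, (forall j, (j < i)%N -> s`_j = s'`_j) /\ lt_bang s`_i s'`_i).

(* Main.v *)
Require Import Defs.
From mathcomp Require Import all_boot all_order all_algebra.
From mathcomp Require Import boolp zify.

Set Implicit Arguments.
Unset Strict Implicit.
Unset Printing Implicit Defensive.

Import Order.TTheory GRing.Theory Num.Theory.
Local Open Scope ring_scope.

(** A local map between standard complexes can be replaced by a diagonal one,
    [T_i |-> c_i T'_i], and the diagonal maps are governed by an elementary
    recursion on the scalars [c_i].

    Both [omega] and the differential of a standard complex match up basis
    vectors: a consecutive pair [T_i], [T_(i+1)] is joined by a single arrow,
    for [omega] when [i] is even and for the differential when [i] is odd, and
    its direction and power of [U] are read off from [s_i].  Nothing else maps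
    to [T_i] or [T_(i+1)] under the same operator.  Hence, when a morphism [f]
    is compared with the two operators at [T_i] and [T_(i+1)], only the
    diagonal entries [c_i] (the coefficient of [T'_i] in [f T_i]) enter, and
    they satisfy two edge equations for each [i]: one for an arrow from [i] to
    [i+1], the other for an arrow from [i+1] to [i].  They hold exactly for odd
    [i], and modulo [U] for even [i], because the differential vanishes modulo
    [U], so that a homotopy contributes nothing modulo [U].  Since [T_0]
    generates the homology modulo [U]-torsion, [f] is local exactly when
    [c_0 = 1].  This is [local_weights].  Conversely, a solution [c] of the
    edge equations whose entries have the right degrees defines a diagonal
    local map, [weights_local].

    It remains to see that the edge equations are solvable exactly when the
    sequences are in lexicographic order.  As long as they agree, the equations
    propagate [c_i = 1 mod U] from [i] to [i+1].  At the first disagreement [k],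
    where [c_k = 1 mod U], the two edge equations exclude precisely
    [s'_k <! s_k]: the order of [Z^!] records which arrows, and which powers
    of [U], can be compared ([weights_lex_le]).  If [s_k <! s'_k], then [c = 1]
    up to [k], and after that [c = 0], apart from one power of [U] at [k+1]
    when the arrows at [k] have the same direction, is a solution
    ([lex_le_weights]). *)

(** * Polynomials over the field with two elements *)

Lemma F2_neq0_eq1 (a : 'F_2) : a != 0 -> a = 1.
Proof. by case: a => -[|[|m]] // hm _; apply/val_inj. Qed.

Lemma dvdUn_le m n (p q : F2U) : U ^+ m * p = U ^+ n * q -> q`_0 = 1 -> (m <= n)%N.
Proof.
move=> /(congr1 (fun r : F2U => r`_n)); rewrite !coefXnM ltnn subnn [(m <= n)%N]leqNgt.
by case: (n < m)%N => // <- /esym/eqP; rewrite oner_eq0.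
Qed.

Lemma mulUn_neq0 n (q : F2U) : q`_0 = 1 -> U ^+ n * q <> 0.
Proof.
move=> q0 /eqP; rewrite mulf_eq0 (negbTE (Um_neq0 _)) => q0'.
by move/esym/eqP: q0; rewrite (eqP q0') coef0 oner_eq0.
Qed.

(** The [i]-th coordinate has the degree of the vector only through its constant
    term; every higher power of [U] would lower the degree. *)
Lemma homog_coef1 n (g : 'I_n -> int) (x : 'rV[F2U]_n) (i : 'I_n) :
  homog g (g i) x -> x 0 i != 0 -> x 0 i = 1.
Proof.
move=> hx nz; suff xE : x 0 i = ((x 0 i)`_0)%:P.
  by move: nz; rewrite xE polyC_eq0 => /F2_neq0_eq1 ->.
apply/polyP => -[|k]; rewrite coefC //=.
have [//|/hx] := eqVneq (x 0 i)`_k.+1 0; lia.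
Qed.

(** * Coordinates indexed by natural numbers *)

(** Coordinates outside the range are [0], so that the two ends of a standard
    complex need no separate treatment. *)
Definition entry n (x : 'rV[F2U]_n) (i : nat) : F2U := oapp (x 0) 0 (insub i).

Lemma entry_ord n (x : 'rV[F2U]_n) (j : 'I_n) : entry x j = x 0 j.
Proof. by rewrite /entry valK. Qed.

Lemma entry_out n (x : 'rV[F2U]_n) i : (n <= i)%N -> entry x i = 0.
Proof. by rewrite leqNgt => h; rewrite /entry insubN. Qed.

Lemma entryD n (x y : 'rV[F2U]_n) i : entry (x + y) i = entry x i + entry y i.
Proof. by rewrite /entry; case: insub => [j|] /=; rewrite ?addr0 ?mxE. Qed.

Lemma entryZ n a (x : 'rV[F2U]_n) i : entry (a *: x) i = a * entry x i.
Proof. by rewrite /entry; case: insub => [j|] /=; rewrite ?mulr0 ?mxE. Qed.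

Lemma entry0 n i : entry (0 : 'rV[F2U]_n) i = 0.
Proof. by rewrite -(scale0r 0) entryZ mul0r. Qed.

Lemma entry_sum n (I : finType) (F : I -> 'rV[F2U]_n) i :
  entry (\sum_j F j) i = \sum_j entry (F j) i.
Proof.
elim/big_rec2: _ => [|j y x _ <-]; first exact: entry0.
by rewrite entryD.
Qed.

Lemma sum_entry n (x : 'rV[F2U]_n) i (v : F2U) :
  \sum_(j < n) x 0 j * (if j == i :> nat then v else 0) = entry x i * v.
Proof.
have [iN|iN] := ltnP i n; last first.
  rewrite entry_out // mul0r big1 // => j _; rewrite ifN ?mulr0 //.
  by have := ltn_ord j; lia.
rewrite (bigD1 (Ordinal iN)) //= eqxx big1 => [|j].
  by rewrite addr0 -(entry_ord x (Ordinal iN)).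
by rewrite -val_eqE /= => /negbTE->; rewrite mulr0.
Qed.

(** * The arrows of a standard complex *)

Section Arrows.
Variable s : std_seq.
Let N := (size s).+1.

(** The weight of the arrow from [T_i] to [T_(i+1)]; [0] stands for no arrow. *)
Definition fwd (i : nat) : F2U :=
  if odd i then (if s`_i < 0 then U ^+ absz s`_i else 0) else (s`_i == -1)%:R.

(** The weight of the arrow from [T_(i+1)] to [T_i]. *)
Definition bwd (i : nat) : F2U :=
  if odd i then (if 0 < s`_i then U ^+ absz s`_i else 0) else (s`_i == 1)%:R.

(** The operator that joins [T_i] and [T_(i+1)]; only the parity of [i] matters. *)
Definition arrows (i : nat) : {linear 'rV[F2U]_N -> 'rV[F2U]_N} :=
  if odd i then std_bd s else std_omega s.

(** [T_j] lies on two edges, to [T_(j+1)] and to [T_(j-1)], and exactly one of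
    them belongs to the operator of parity [i]. *)
Definition arrow_gen (i j : nat) : 'rV[F2U]_N :=
  if odd j == odd i then fwd j *: T s j.+1
  else if j is j'.+1 then bwd j' *: T s j' else 0.

Lemma fwd_out i : (size s <= i)%N -> fwd i = 0.
Proof. by move=> h; rewrite /fwd nth_default // if_same. Qed.

Lemma bwd_out i : (size s <= i)%N -> bwd i = 0.
Proof. by move=> h; rewrite /bwd nth_default // if_same. Qed.

Lemma T_out i : (N <= i)%N -> T s i = 0.
Proof.
move=> h; apply/rowP => j; rewrite !mxE (_ : (j == i :> nat) = false) //.
by apply: contra_leqF h => /eqP <-; exact: ltn_ord.
Qed.

Lemma entryT i j : entry (T s i) j = ((i == j) && (j < N)%N)%:R.
Proof.
have [jN|jN] := ltnP j N; last by rewrite entry_out // andbF.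
by rewrite -[X in entry _ X]/(nat_of_ord (Ordinal jN)) entry_ord mxE /= andbT eq_sym.
Qed.

Lemma arrowsE i x : arrows i x = \sum_(j < N) x 0 j *: arrow_gen i j.
Proof.
rewrite /arrows /arrow_gen /fwd /bwd; case: ifP => oi.
  rewrite [LHS]lin_extE; apply: eq_bigr => -[j jN] _ /=; congr (_ *: _).
  rewrite /std_bd_gen; case: ifP => oj; first by case: ifP; rewrite ?scale0r.
  case: j jN oj => [|j] jN //= /negbFE ->.
  by case: ifP; rewrite ?scale0r.
rewrite [LHS]lin_extE; apply: eq_bigr => -[j jN] _ /=; congr (_ *: _).
rewrite /std_omega_gen; case: ifP => oj; last first.
  by case: ifP; rewrite ?scale0r ?scale1r.
case: j jN oj => [|j] jN //= /negbTE ->.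
by case: ifP; rewrite ?scale0r ?scale1r.
Qed.

Lemma arrowsT i j : arrows i (T s j) = arrow_gen i j.
Proof.
have [jN|jN] := ltnP j N.
  rewrite arrowsE (bigD1 (Ordinal jN)) //= big1 => [|m].
    by rewrite mxE eqxx scale1r addr0.
  by rewrite -val_eqE /= mxE => /negbTE->; rewrite scale0r.
rewrite T_out // linear0 /arrow_gen; case: ifP => _.
  by rewrite fwd_out ?scale0r //; apply: ltnW.
by case: j jN => // j jN; rewrite bwd_out ?scale0r.
Qed.

Lemma arrowsT_fwd i : arrows i (T s i) = fwd i *: T s i.+1.
Proof. by rewrite arrowsT /arrow_gen eqxx. Qed.

Lemma arrowsT_bwd i : arrows i (T s i.+1) = bwd i *: T s i.
Proof. by rewrite arrowsT /arrow_gen /=; case: (odd i). Qed.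

(** The only arrow of this parity that can end at [T_(i+1)] starts at [T_i]: this
    is what makes the diagonal entries of a morphism close up on themselves. *)
Lemma entry_arrows_fwd i x : entry (arrows i x) i.+1 = fwd i * entry x i.
Proof.
rewrite arrowsE entry_sum mulrC -sum_entry; apply: eq_bigr => j _.
rewrite entryZ; congr (_ * _); rewrite /arrow_gen.
have [ji|ji] := nat_of_ord j =P i.
  rewrite -ji eqxx entryZ entryT eqxx /=; case: (ltnP j.+1 N) => h; rewrite ?mulr1 //.
  by rewrite fwd_out ?mul0r.
case: ifP => oj; first by rewrite entryZ entryT eqSS (introF eqP ji) mulr0.
case: (nat_of_ord j) oj ji => [|j'] oj ji; first exact: entry0.
rewrite entryZ entryT (_ : (j' == i.+1) = false) ?mulr0 //.
by apply: contraFF oj => /eqP -> /=; rewrite negbK.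
Qed.

Lemma entry_arrows_bwd i x : entry (arrows i x) i = bwd i * entry x i.+1.
Proof.
rewrite arrowsE entry_sum mulrC -sum_entry; apply: eq_bigr => j _.
rewrite entryZ; congr (_ * _); rewrite /arrow_gen.
have [ji|ji] := nat_of_ord j =P i.+1.
  rewrite ji /= (_ : (~~ odd i == odd i) = false); last by case: (odd i).
  rewrite entryZ entryT eqxx /=; case: (ltnP i N) => h; rewrite ?mulr1 //.
  by rewrite bwd_out ?mul0r //; apply: ltnW.
case: ifP => oj.
  rewrite entryZ entryT (_ : (j.+1 == i) = false) ?mulr0 //.
  by apply: contraTF oj => /eqP <- /=; case: (odd j).
case: (nat_of_ord j) ji oj => [|j'] ji oj; first exact: entry0.
by rewrite entryZ entryT -eqSS (introF eqP ji) mulr0.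
Qed.

Lemma size_le_nth0 i : s`_i = 0 -> (size s <= i)%N.
Proof.
move=> si; rewrite leqNgt; apply/negP => h.
have [oi|oi] := boolP (odd i); first by have := std_b h oi; rewrite si eqxx.
by have := std_a h oi; rewrite si.
Qed.

Lemma nth_even i : ~~ odd i -> s`_i \in [:: -1; 0; 1].
Proof.
move=> oi; have [h|h] := ltnP i (size s); last by rewrite nth_default.
by have := std_a h oi; rewrite !inE => /orP[] -> //; rewrite !orbT.
Qed.

End Arrows.

(** * Diagonal entries and edge equations *)

(** Morphisms commute with the differential exactly, but with [omega] only
    modulo [U]. *)
Definition edge_eq (i : nat) (p q : F2U) : Prop :=
  if odd i then p = q else p`_0 = q`_0.

(** The conditions for [T_i |-> c_i T'_i] to be local and to commute with both
    operators. *)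
Definition weights (s s' : std_seq) (c : nat -> F2U) : Prop :=
  c 0%N = 1 /\ forall i,
    edge_eq i (fwd s i * c i.+1) (fwd s' i * c i) /\
    edge_eq i (bwd s i * c i) (bwd s' i * c i.+1).

(** The condition for [T_i |-> c_i T'_i] to preserve the grading. *)
Definition graded_weights (s s' : std_seq) (c : nat -> F2U) : Prop :=
  forall (i : 'I_(size s).+1) (j : 'I_(size s').+1), i = j :> nat ->
    forall k, (c i)`_k != 0 -> std_gr j - (2 * k)%:Z = std_gr i.

(** * Local maps in terms of their diagonal entries *)

Section LocalMaps.
Variables s s' : std_seq.

(** The exponent of the tower decomposition stated without its explicit value. *)
Lemma hclass_tower (r : std_seq) : exists m, forall x : Defs.cycle (std_gcomplex r),
  U ^+ m *: hclass x = (U ^+ m * (val x : 'rV_(size r).+1) 0 0) *: hclass (std_T0 r).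
Proof. by eexists=> x; exact: std_hclass. Qed.

(** Modulo [U]-torsion, [V] and [W] are generated by [a] and [b], so inverting [U]
    makes them free of rank one, and a map that sends [a] to [b] modulo torsion
    becomes an isomorphism.  It suffices that [b] is free: then so is [a]. *)
Lemma loc_map_bij (V W : lmodType F2U) (g : {linear V -> W}) (a : V) (b : W) m n :
    (forall x, exists r, U ^+ m *: x = r *: a) ->
    (forall y, exists r, U ^+ n *: y = r *: b) ->
    (forall r, r *: b = 0 -> r = 0) -> U ^+ n *: g a = U ^+ n *: b ->
  bijective (loc_map (t := U) g).
Proof.
move=> Va Wb b_free gab.
have gE r k : loc_map (t := U) g (Defs.frac U (r *: a) k) = Defs.frac U (r *: b) k.
  rewrite loc_mapE linearZ_LR; apply: (@fracC _ _ _ n).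
  by rewrite !scalerA exprD -mulrA mulrC -!(scalerA _ (U ^+ n)) gab.
have g_ker z : loc_map (t := U) g z = 0 -> z = 0.
  have [x [k ->]] := fracW z; have [r xr] := Va x.
  rewrite -(fracUl U m x k) xr gE => /frac_eq0[l]; rewrite scalerA => /b_free/eqP.
  by rewrite mulf_eq0 (negbTE (Um_neq0 _)) => /eqP->; rewrite scale0r frac0.
have g_inj : injective (loc_map (t := U) g) by apply: raddf_inj; exact: g_ker.
have g_surj z : exists w, loc_map (t := U) g w = z.
  have [y [k ->]] := fracW z; have [r yr] := Wb y.
  by exists (Defs.frac U (r *: a) (n + k)); rewrite gE -yr fracUl.
have [h hh] := choice g_surj; exists h => // w.
by apply: g_inj; rewrite hh.
Qed.

(** Modulo [U]-torsion a cycle is homologous to its [T_0]-coefficient times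
    [T_0], so on localized homology [f] is multiplication by the
    [T'_0]-coefficient of [f T_0]; this coefficient is homogeneous of degree [0],
    hence [0] or [1]. *)
Lemma is_local_coef (f : ai_morphism (std_complex s) (std_complex s')) :
  is_local f <-> (f (T s 0) : 'rV_(size s').+1) 0 0 = 1.
Proof.
have [m hm] := hclass_tower s; have [n hn] := hclass_tower s'.
have fT0 : U ^+ n *: homology_map f (hclass (std_T0 s)) =
    (U ^+ n * (f (T s 0) : 'rV_(size s').+1) 0 0) *: hclass (std_T0 s').
  by rewrite homology_mapE; exact: (hn (Defs.cycle_map f (std_T0 s))).
split=> [/bij_inj f_inj|f0].
  apply: (homog_coef1 (g := @std_gr s')).
    have := @cmap_degree _ _ f 0 (T s 0); rewrite addr0 std_gr0; apply.
    by rewrite -(std_gr0 s); exact: (@homogT s ord0).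
  apply/eqP => f0; have : Defs.frac U (hclass (std_T0 s)) 0 = 0.
    apply: f_inj; rewrite [LHS]loc_mapE [RHS]linear0.
    by apply/frac_eq0; exists n; apply: (etrans fT0); rewrite f0 mulr0 scale0r.
  by move/frac_eq0 => [l /std_hclass0/eqP]; apply/negP/Um_neq0.
apply: (@loc_map_bij _ _ _ (hclass (std_T0 s)) (hclass (std_T0 s')) m n).
- by move=> c; have [x ->] := hclassW c; eexists; exact: hm.
- by move=> c; have [x ->] := hclassW c; eexists; exact: hn.
- exact: std_hclass0.
- by apply: (etrans fT0); rewrite f0 mulr1.
Qed.

(** The differentials vanish modulo [U], so the homotopy between [f iota] and
    [iota f] disappears modulo [U]; and [f] cancels out of [iota = 1 + omega]. *)
Lemma map_omega_modU (f : ai_morphism (std_complex s) (std_complex s')) x :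
  exists y : 'rV[F2U]_(size s').+1,
    (f (std_omega s x) : 'rV_(size s').+1) = std_omega s' (f x) + U *: y.
Proof.
have [H _ /(_ x)[y hy]] := ai_map_iota f.
pose phi : {linear 'rV[F2U]_(size s).+1 -> 'rV[F2U]_(size s').+1} := f.
pose K : {linear 'rV[F2U]_(size s).+1 -> 'rV[F2U]_(size s').+1} := H.
have [z hz] := std_bd_imU x; have [w hw] := std_bd_imU (K x).
exists (y + K z + w : 'rV_(size s').+1).
have {}hy : (phi x + phi (std_omega s x)) + (phi x + std_omega s' (phi x)) +
    U *: K z + U *: w = U *: (y : 'rV_(size s').+1).
  by rewrite -[phi x + phi _]linearD -linearZ_LR -hz -hw; exact: hy.
(* In characteristic 2 all terms but the two with omega occur twice. *)
rewrite -/(phi _) !scalerDr -hy addrACA char2 add0r.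
move: (phi _) (std_omega s' _) (U *: K z) (U *: w) => b e p q.
rewrite [b + e + p + q + p]addrAC -[b + e + p + p]addrA char2 addr0.
by rewrite -[b + e + q + q]addrA char2 addr0 [RHS]addrC -addrA char2 addr0.
Qed.

(** Each edge equation compares [f] after an operator with the operator after
    [f], at one end of the edge and in the coordinate of the other end.  *)
Lemma local_weights (f : ai_morphism (std_complex s) (std_complex s')) :
  is_local f -> weights s s' (fun i => entry (f (T s i)) i).
Proof.
move/is_local_coef => f0; split.
  by rewrite -f0; exact: (entry_ord (f (T s 0)) ord0).
move=> i.
have edge x j : edge_eq i (entry (f (arrows s i x)) j) (entry (arrows s' i (f x)) j).
  rewrite /edge_eq /arrows; case: (odd i).
    by rewrite -[RHS]/(entry (bd (std_complex s') (f x)) j) -cmap_bd.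
  have [y ->] := map_omega_modU f x; rewrite entryD coefD entryZ.
  by rewrite -['X * _]mulrC coefMX addr0.
split.
  have := edge (T s i) i.+1; rewrite entry_arrows_fwd arrowsT_fwd.
  by rewrite [cmap f _]linearZ_LR entryZ.
have := edge (T s i.+1) i; rewrite entry_arrows_bwd arrowsT_bwd.
by rewrite [cmap f _]linearZ_LR entryZ.
Qed.

Section DiagonalMap.
Variables (c : nat -> F2U) (cw : weights s s' c).

Let f := lin_ext (size s).+1 (fun i => c i *: T s' i).

(** Applied to [T_j], both composites of a diagonal map with an operator are
    multiples of one basis vector, and their scalars are the two sides of an edge
    equation; the parity of [i] selects the operator. *)
Lemma diag_arrows i j : (j < (size s).+1)%N -> exists m, exists p q : F2U,
  [/\ edge_eq i p q, f (arrows s i (T s j)) = p *: T s' m &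
      arrows s' i (f (T s j)) = q *: T s' m].
Proof.
move=> jN; have fT k : (k < (size s).+1)%N -> f (T s k) = c k *: T s' k by exact: lin_extT.
have [_ edge] := cw; rewrite fT // linearZ_LR !arrowsT /arrow_gen.
have [oj|oj] := eqVneq (odd j) (odd i).
  exists j.+1, (fwd s j * c j.+1), (fwd s' j * c j).
  split; first by have [] := edge j; rewrite /edge_eq oj.
    have [h|h] := ltnP j (size s); first by rewrite linearZ_LR fT // scalerA.
    by rewrite fwd_out // mul0r !scale0r linear0.
  by rewrite scalerA mulrC.
case: j jN oj => [|j] jN oj.
  (* No arrow joins T_0 to an earlier basis vector. *)
  by exists 0%N, 0, 0; rewrite !scale0r scaler0 linear0; split=> //; rewrite /edge_eq; case: odd.
have {}oj : odd j = odd i by move: oj => /=; case: (odd j) (odd i) => -[].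
exists j, (bwd s j * c j), (bwd s' j * c j.+1).
split; first by have [] := edge j; rewrite /edge_eq oj.
  by rewrite linearZ_LR fT ?scalerA // ltnW.
by rewrite scalerA mulrC.
Qed.

Lemma diag_bd x : f (std_bd s x) = std_bd s' (f x).
Proof.
apply: (linT (f := f \o std_bd s) (g := std_bd s' \o f)) => j jN.
have [m [p [q [/= e fp fq]]]] := diag_arrows 1 jN.
by apply: (etrans fp); rewrite e; exact: esym.
Qed.

Lemma diag_omega x : exists y, f (std_omega s x) + std_omega s' (f x) = U *: y.
Proof.
rewrite [x]sumT !linear_sum -big_split /=.
elim/big_ind: _ => [|_ _ [y ->] [z ->]|j _].
- by exists 0; rewrite scaler0.
- by exists (y + z); rewrite scalerDr.
have [m [p [q [/= e fp fq]]]] := diag_arrows 0 (ltn_ord j).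
have [r hr] : exists r, p - q = r * 'X.
  have : root (p - q) 0 by rewrite rootE horner_coef0 coefB e subrr.
  by case/factor_theorem => r; rewrite subr0; exists r.
exists (x 0 j *: (r *: T s' m)).
have fwE : f (std_omega s (x 0 j *: T s j)) = x 0 j *: (p *: T s' m).
  by rewrite [std_omega s _]linearZ_LR [LHS]linearZ_LR; congr (_ *: _).
have wfE : std_omega s' (f (x 0 j *: T s j)) = x 0 j *: (q *: T s' m).
  by rewrite [f _]linearZ_LR [LHS]linearZ_LR; congr (_ *: _).
apply: (etrans (congr2 +%R fwE wfE)).
rewrite -scalerDr [RHS]scalerA mulrC -scalerA [U *: (r *: _)]scalerA [U * r]mulrC -hr.
congr (_ *: _); rewrite scalerBl.
(* The signs differ, but the characteristic is 2. *)
by rewrite -[LHS]addr0 -(subrr (q *: T s' m)) addrA -[_ + _ + q *: _]addrA char2 addr0.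
Qed.

Lemma weights_local : graded_weights s s' c ->
  ai_le (std_complex s) (std_complex s').
Proof.
move=> c_degree.
have f_degree : has_degree (gr (std_complex s)) (gr (std_complex s')) 0 f.
  apply: lin_ext_degree => i; rewrite addr0.
  have [h|h] := ltnP i (size s').+1; last by rewrite T_out // scaler0; exact: homog0.
  apply: (homogZ _ (@homogT s' (Ordinal h))); exact: c_degree.
pose F : chain_map (std_complex s) (std_complex s') :=
  ChainMap (C1 := std_complex s) (C2 := std_complex s') f_degree diag_bd.
have F_iota : homotopic_modU (F \o iotabar (std_complex s)) (iotabar (std_complex s') \o F).
  exists \0 => [d x _|x]; first exact: homog0.
  have [y hy] := diag_omega x; exists (y : chains (std_complex s')).
  change (f (x + std_omega s x) + (f x + std_omega s' (f x)) + 0 + std_bd s' 0 = U *: y).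
  by rewrite linear0 !addr0 linearD addrACA char2 add0r.
exists (AIMorphism F_iota); apply/is_local_coef.
have [c0 _] := cw; change (f (T s 0) 0 0 = 1).
by rewrite /f lin_extT // c0 scale1r mxE.
Qed.

End DiagonalMap.

(** * Edge equations and the lexicographic order *)

Lemma weights_lex_le c : weights s s' c -> lex_le s s'.
Proof.
case=> c0 edge.
have [diff|same] := pselect (exists i, s`_i != s'`_i); last first.
  by left=> i; apply/eqP; apply: contra_notT same; exists i.
right; case: (ex_minnP diff) => k sk kmin.
have eq_lt j : (j < k)%N -> s`_j = s'`_j.
  by move=> jk; apply/eqP; apply: contraLR jk => /kmin; rewrite -leqNgt.
exists k; split=> //.
(* Before k the two arrows agree, and each edge has an arrow, which transports
   the constant term: a zero entry of s would end both sequences before k. *)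
have ck j : (j <= k)%N -> (c j)`_0 = 1.
  elim: j => [_|j IH jk]; first by rewrite c0 coef1.
  have [] := edge j; rewrite /fwd /bwd /edge_eq -(eq_lt j jk).
  have := IH (ltnW jk); have : s`_j != 0.
    apply: contraNneq sk => sj0; have sj' : s'`_j = 0 by rewrite -eq_lt.
    rewrite !nth_default //; last exact: leq_trans (size_le_nth0 sj0) (ltnW jk).
    exact: leq_trans (size_le_nth0 sj') (ltnW jk).
  have [oj|oj] /= := boolP (odd j) => sj cj.
    case: ltrgtP sj => // sj _ e e'; last by have := mulfI (Um_neq0 _) e' => <-.
    by have := mulfI (Um_neq0 _) e => ->.
  have := nth_even s oj; rewrite !inE (negbTE sj) orFb => /orP[] /eqP ->.
    by rewrite !mul1r => ->.
  by rewrite !mul1r => _ <-.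
(* At k the edge equations compare the arrow of s with a different arrow of s'. *)
have [] := edge k; have := ck k (leqnn k); move: sk; rewrite /fwd /bwd /edge_eq /lt_bang.
have [ok|ok] /= := boolP (odd k).
  move: s`_k s'`_k => a b.
  case: (ltrgtP a 0) => sa; case: (ltrgtP b 0) => sb //=; rewrite ?mul0r ?sa ?sb //.
  - by move=> ne cw e _; have := dvdUn_le e cw; lia.
  - by move=> _ cw /esym/(mulUn_neq0 cw).
  - by move=> ne cw _ /esym e; have := dvdUn_le e cw; lia.
  - by move=> _ cw _ /(mulUn_neq0 cw).
  - by move=> _ cw /esym/(mulUn_neq0 cw).
have := nth_even s ok; have := nth_even s' ok; rewrite !inE.
by move=> /or3P[] /eqP -> /or3P[] /eqP -> //= _; rewrite ?mul0r ?mul1r ?coef0 => -> //.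
Qed.

(** Past the first disagreement [k] the map is cut off.  The cut must keep
    [T_(k+1)] when the differentials at [k] point the same way with exponents
    [|s_k|] and [|s'_k|]: the quotient of the two powers of [U] then belongs
    there, and the order on [Z^!] makes this quotient a power of [U].  It is
    divisible by [U], so it is invisible to the next edge, an edge of [omega]. *)
Lemma lex_le_weights : lex_le s s' -> exists2 c, weights s s' c & graded_weights s s' c.
Proof.
have edge_refl i p : edge_eq i p p by rewrite /edge_eq; case: odd.
case=> [eq_all|[k [eq_lt ltk]]].
  exists (fun=> 1); first by split=> // i; rewrite /fwd /bwd eq_all.
  move=> i j ij l; rewrite coef1; case: l => //= _.
  rewrite subr0 /std_gr ij; apply: eq_bigr => l _.
  by rewrite eq_all.
pose c i : F2U := if (i <= k)%N then 1 else
  if [&& i == k.+1, odd k & 0 < s`_k * s'`_k] then U ^+ absz (s`_k - s'`_k)%R else 0.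
have ne_k : s`_k != s'`_k.
  by apply: contraTneq ltk => ->; rewrite /lt_bang; case: ltrgtP; rewrite ?ltxx.
have c_le i : (i <= k)%N -> c i = 1 by rewrite /c => ->.
have c_gt i : (k.+1 < i)%N -> c i = 0.
  by move=> ki; rewrite /c leqNgt (ltnW ki) /= gtn_eqF.
have cSk : c k.+1 = if odd k && (0 < s`_k * s'`_k) then U ^+ absz (s`_k - s'`_k)%R else 0.
  by rewrite /c ltnn eqxx.
exists c.
  split=> [|i]; first exact: c_le.
  have [ik|ki|->] := ltngtP i k.
  - by rewrite (c_le i.+1) // (c_le i (ltnW ik)) /fwd /bwd eq_lt //; split; apply: edge_refl.
  - rewrite (c_gt i.+1) //; have [->|ik] := eqVneq i k.+1; last first.
      by rewrite c_gt ?mulr0 // ltn_neqAle eq_sym ik.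
    rewrite cSk /edge_eq /= !mulr0; case: (odd k) => /=; last by rewrite !mulr0.
    case: ifP => _; rewrite ?mulr0 // !coef0M coefXn coef0.
    by rewrite eq_sym absz_eq0 subr_eq0 (negbTE ne_k) mulr0n !mulr0.
  - rewrite cSk c_le // !mulr1 /edge_eq /fwd /bwd; move: ltk ne_k; rewrite /lt_bang.
    have [ok|ok] /= := boolP (odd k).
      move: s`_k s'`_k => a b.
      case: (ltrgtP a 0) => sa; case: (ltrgtP b 0) => sb //=; rewrite ?mul0r ?sa ?sb //.
      - rewrite nmulr_rgt0 // sb -exprD => ba _; split=> //; congr (_ ^+ _); lia.
      - by rewrite nmulr_rgt0 // ltNge (ltW sb) !mulr0.
      - by rewrite mulr0 ltxx !mulr0.
      - rewrite pmulr_rgt0 // sb -exprD => ba _; split=> //; congr (_ ^+ _); lia.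
      - by rewrite mul0r ltxx !mulr0.
    have := nth_even s ok; have := nth_even s' ok; rewrite !inE.
    by move=> /or3P[] /eqP -> /or3P[] /eqP -> //= _; rewrite ?mul0r ?mulr0 ?coef0.
(* The grading of T_i depends on the entries before i only. *)
move=> i j ij l.
have grE n : (n <= k)%N -> \sum_(0 <= m < n | odd m) (sgz s'`_m - 2 * s'`_m) =
    \sum_(0 <= m < n | odd m) (sgz s`_m - 2 * s`_m).
  move=> nk; apply: congr_big_nat => // m /andP[_ /andP[_ mn]].
  by rewrite eq_lt // (leq_trans mn).
rewrite /std_gr -ij; have [ik|ki] := leqP i k.
  by rewrite c_le // coef1; case: l => //= _; rewrite subr0 grE.
have [->|ik] := eqVneq (i : nat) k.+1; last first.
  by rewrite c_gt ?coef0 ?eqxx // ltn_neqAle eq_sym ik.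
rewrite cSk; case: ifP => [/andP[ok ss]|_]; last by rewrite coef0 eqxx.
(* At k.+1 the exponent of U makes up for the difference of the gradings. *)
rewrite coefXn; have [-> _|_] := eqVneq l; last by rewrite eqxx.
rewrite !(big_mkcond (fun m => odd m)) !big_nat_recr //= -!big_mkcond grE // ok.
move: ltk ss; rewrite /lt_bang; move: (\sum_(_ <= _ < _ | _) _) => g.
move: s`_k s'`_k => a b.
case: (ltrgt0P a) => sa /=; case: (ltrgt0P b) => sb //=.
- by rewrite !gtr0_sgz // => ba _; lia.
- by rewrite nmulr_rgt0 // ltNge (ltW sb).
- by rewrite !ltr0_sgz // => ba _; lia.
- by rewrite sb mulr0 ltxx.
- by rewrite sa mul0r ltxx.
Qed.

End LocalMaps.

Theorem theorem4p6 (s s' : std_seq) :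
  ai_le (std_complex s) (std_complex s') <-> lex_le s s'.
Proof.
split=> [[f /local_weights/weights_lex_le]//|].
by case/lex_le_weights => c; apply: weights_local.
Qed.
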